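(* There exist a problem instance (a number of agents $N$, a connected undirected graph on the agents, and continuously differentiable functions $f_1,\dots,f_N:\mathbb{R}\to\mathbb{R}$) whose average $f=\frac1N\sum_{i=1}^N f_i$ satisfies the global Lipschitz condition (GLC), and an associated mixing matrix $\mathbf W\in\mathbb{R}^{N\times N}$, such that for every stepsize $\alpha>0$ (no matter how small) there is an initial point $\mathbf x^0\in\mathbb{R}^{N}$ for which the gradient tracking (GT) iteration $$\mathbf x^{r+1}=2\mathbf W\mathbf x^{r}-\mathbf W^2\mathbf x^{r-1}-\alpha\nabla g(\mathbf x^{r})+\alpha\nabla g(\mathbf x^{r-1}),\qquad r\ge 1,$$ started from $\mathbf x^0$, diverges to infinity.
   Context: Decentralized problem: minimize $\frac1N\sum_{i=1}^N f_i(x_i)$ subject to $x_i=x_j$ whenever agents $i,j$ are neighbors in an undirected connected graph $G=(\mathcal V,\mathcal E)$ with $|\mathcal V|=N$; the optimization variable of each agent is a scalar ($K=1$). Write $\mathbf x=[x_1;\dots;x_N]$ and $\nabla g(\mathbf x):=[f_1'(x_1);\dots;f_N'(x_N)]\in\mathbb{R}^N$. GLC: there is a finite $L>0$ with $\|\nabla f(y)-\nabla f(z)\|\le L\|y-z\|$ for all $y,z$, where $f(u)=\frac1N\sum_{i=1}^N f_i(u)$. Mixing matrix for $G$: a symmetric $\mathbf W\in\mathbb{R}^{N\times N}$ with $\mathrm{Null}(\mathbf I_N-\mathbf W)=\mathrm{span}\{\mathbf 1\}$, $-\mathbf I_N\preceq\mathbf W\preceq\mathbf I_N$, $W_{ij}=0$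 if $i\neq j$ and $(i,j)\notin\mathcal E$, and $W_{ij}>0$ otherwise. The GT iteration is the simplified form of $\mathbf x^{r+1}=\mathbf W\mathbf x^r-\alpha\mathbf y^r$, $\mathbf y^{r+1}=\mathbf W\mathbf y^r+\nabla g(\mathbf x^{r+1})-\nabla g(\mathbf x^r)$; it is initialized with $\mathbf y^0=\nabla g(\mathbf x^0)$, i.e. the first step is $\mathbf x^1=\mathbf W\mathbf x^0-\alpha\nabla g(\mathbf x^0)$. ''Diverges to infinity'' means $\|\mathbf x^r\|\to\infty$ as $r\to\infty$. *)

(* Defs.v *)
From mathcomp Require Import all_boot all_order all_algebra.
From mathcomp Require Import all_classical all_reals all_analysis.

Set Implicit Arguments.
Unset Strict Implicit.
Unset Printing Implicit Defensive.

Import Order.TTheory GRing.Theory Num.Theory.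
Import numFieldNormedType.Exports.
Local Open Scope classical_set_scope.
Local Open Scope ring_scope.

Record connected_graph (N : nat) (e : rel 'I_N) : Prop := ConnectedGraph {
  cg_sym : symmetric e;
  cg_irrefl : irreflexive e;
  cg_connected : forall i j : 'I_N, connect e i j
}.

Definition C1 (R : realType) (f : R -> R) : Prop :=
  (forall u : R, derivable f u 1) /\ continuous (derive1 f).

Definition average (R : realType) (N : nat) (f : 'I_N -> R -> R) : R -> R :=
  fun u => N%:R^-1 * \sum_(i < N) f i u.

Definition GLC (R : realType) (N : nat) (f : 'I_N -> R -> R) : Prop :=
  exists2 L : R, 0 < L &
    forall y z : R,
      `|derive1 (average f) y - derive1 (average f) z| <= L * `|y - z|.

Definition loewner_le (R : realType) (N : nat) (A B : 'M[R]_N) : Prop :=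
  forall v : 'cV[R]_N, 0 <= (v^T *m (B - A) *m v) 0 0.

Record mixing_matrix (R : realType) (N : nat) (e : rel 'I_N)
    (W : 'M[R]_N) : Prop := MixingMatrix {
  mix_sym : W^T = W;
  mix_null : forall v : 'cV[R]_N,
    (1%:M - W) *m v = 0 <-> exists c : R, v = c *: const_mx 1;
  mix_ge : loewner_le (- 1%:M) W;
  mix_le : loewner_le W 1%:M;
  mix_zero : forall i j : 'I_N, i != j -> ~~ e i j -> W i j = 0;
  mix_pos : forall i j : 'I_N, (i == j) || e i j -> 0 < W i j
}.

Definition grad_g (R : realType) (N : nat) (f : 'I_N -> R -> R)
    (x : 'cV[R]_N) : 'cV[R]_N :=
  \col_(i < N) derive1 (f i) (x i 0).

(* The recursion determines the whole sequence x from x0. *)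
Record GT_iteration (R : realType) (N : nat) (f : 'I_N -> R -> R)
    (W : 'M[R]_N) (alpha : R) (x0 : 'cV[R]_N) (x : nat -> 'cV[R]_N) : Prop :=
  GTIteration {
  GT_start : x 0%N = x0;
  GT_first : x 1%N = W *m x0 - alpha *: grad_g f x0;
  GT_step : forall r : nat, (1 <= r)%N ->
    x r.+1 = 2 *: (W *m x r) - W *m W *m x r.-1
             - alpha *: grad_g f (x r) + alpha *: grad_g f (x r.-1)
}.

(* The Euclidean norm; `|x| on 'cV[R]_N is the sup norm. *)
Definition enorm (R : realType) (N : nat) (x : 'cV[R]_N) : R :=
  Num.sqrt (\sum_(i < N) x i 0 ^+ 2).

Definition diverges_to_infinity (R : realType) (N : nat)
    (x : nat -> 'cV[R]_N) : Prop :=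
  enorm (x r) @[r --> \oo] --> +oo.

(* Main.v *)
Require Import Defs.
From mathcomp Require Import all_boot all_order all_algebra.
From mathcomp Require Import all_classical all_reals all_analysis.
From mathcomp Require Import ring lra.

Import Order.TTheory GRing.Theory Num.Theory.
Local Open Scope ring_scope.

(** Two agents with [f_0 u = u^3 / 3] and [f_1 u = - u^3 / 3] have the zero
    function as average, so GLC holds, although neither derivative is Lipschitz.
    Let [W] be the averaging matrix, all of whose entries are [1/2], and let
    [v = (1, -1)].  Then [W v = 0], and [grad_g (t v) = t^2 v] ([W_disagreement]
    and [grad_disagreement]), so the line spanned by [v], the disagreement
    direction, is invariant under gradient tracking, and the iteration on it is
    scalar.  For [x^r = - (c_r / alpha) v] the stepsize cancels: the recursion
    becomes [c_(r+1) = c_r^2 - c_(r-1)^2], and the first step is the same formula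
    with [c_(-1) = 0].  From [c_0 = 4] this sequence grows at least geometrically
    ([magnitude_step]).  A smaller stepsize therefore only moves the diverging
    starting point farther away. *)

Section Counterexample.
Variable R : realType.

Definition cubic (i : 'I_2) (u : R) : R := (-1) ^+ i * (u ^+ 3 / 3).

Definition complete_rel : rel 'I_2 := fun i j => i != j.

Definition averaging : 'M[R]_2 := const_mx 2^-1.

Definition disagreement : 'cV[R]_2 := \col_i (-1) ^+ i.

Lemma complete_connected : connected_graph complete_rel.
Proof.
split=> [i j|i|i j]; rewrite /complete_rel ?eqxx //; first by rewrite eq_sym.
by have [->|ij] := eqVneq i j; [exact: connect0 | exact: connect1].
Qed.

Lemma is_derive_cubic i (u : R) :
  is_derive u 1 (cubic i) ((-1) ^+ i * u ^+ 2).
Proof.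
rewrite /cubic; apply: is_derive_eq.
by rewrite /GRing.scale /=; field.
Qed.

Lemma derive1_cubic i : (cubic i)^`()%classic = fun u => (-1) ^+ i * u ^+ 2.
Proof.
apply/funext => u; rewrite derive1E.
exact: (@derive_val _ _ _ _ _ _ _ (is_derive_cubic i u)).
Qed.

Lemma cubic_C1 i : C1 (cubic i).
Proof.
split=> [u|]; first by case: (is_derive_cubic i u).
rewrite derive1_cubic => u.
exact/differentiable_continuous/derivable1_diffP.
Qed.

Lemma average_cubic : average cubic = cst 0.
Proof.
apply/funext => u; rewrite /average big_ord_recl big_ord1 /cubic /=.
by rewrite expr0 expr1; ring.
Qed.

Lemma cubic_GLC : GLC cubic.
Proof.
exists 1 => // y z.
by rewrite average_cubic !derive1_cst subrr normr0 mul1r normr_ge0.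
Qed.

(** For [v = (a, b)], the quadratic forms of [W + I] and [I - W] are
    [a^2 + b^2 + (a + b)^2 / 2] and [(a - b)^2 / 2]. *)
Lemma averaging_mixing : mixing_matrix complete_rel averaging.
Proof.
split=> [|v|v|v|i j ij|i j _].
- by apply/matrixP => i j; rewrite !mxE.
- split=> [/matrixP/(_ 0 0)|[c ->]].
    rewrite !mxE big_ord_recl big_ord1 !mxE /= => v01.
    exists (v 0 0); apply/matrixP => i j; rewrite !mxE mulr1 ord1.
    case: i => -[|[|//]] /= lt_i; first by congr (v _ _); exact: val_inj.
    have -> : Ordinal lt_i = lift ord0 ord0 by exact: val_inj.
    by move: v01; rewrite mulr1n mulr0n; lra.
  apply/matrixP => i j; rewrite !mxE big_ord_recl big_ord1 !mxE.
  by case: i => -[|[|//]] lt_i /=; field.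
- rewrite !(mxE, big_ord_recl, big_ord0) /=.
  by have := sqr_ge0 (v ord0 0 + v (lift ord0 ord0) 0); nra.
- rewrite !(mxE, big_ord_recl, big_ord0) /=.
  by have := sqr_ge0 (v ord0 0 - v (lift ord0 ord0) 0); nra.
- by rewrite /complete_rel ij.
- by rewrite mxE invr_gt0 ltr0n.
Qed.

Lemma W_disagreement : averaging *m disagreement = 0.
Proof.
apply/matrixP => i j; rewrite !mxE big_ord_recl big_ord1 !mxE /=.
by rewrite expr0 expr1 mulrN subrr.
Qed.

(** The coordinates of [t *: disagreement] are [t] and [- t], which squaring
    identifies; the opposite signs of the two functions separate them again. *)
Lemma grad_disagreement (t : R) :
  grad_g cubic (t *: disagreement) = t ^+ 2 *: disagreement.
Proof.
apply/matrixP => i j; rewrite !mxE derive1_cubic exprMn sqrr_sign mulr1.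
exact: mulrC.
Qed.

(** The pair [(c_(r-1), c_r)]; the initial [c_(-1) = 0] turns the first step,
    which has no predecessor, into an instance of the general one. *)
Fixpoint magnitude_pair (r : nat) : R * R :=
  if r is r'.+1 then
    let: (p, q) := magnitude_pair r' in (q, q ^+ 2 - p ^+ 2)
  else (0, 4).

Definition magnitude r := (magnitude_pair r).2.

Lemma magnitude1 : magnitude 1 = magnitude 0 ^+ 2.
Proof. by rewrite /magnitude /= expr0n subr0. Qed.

Lemma magnitudeSS r :
  magnitude r.+2 = magnitude r.+1 ^+ 2 - magnitude r ^+ 2.
Proof. by rewrite /magnitude /=; case: (magnitude_pair r). Qed.

(** For consecutive terms [p, q] with [4 <= p] and [3 p <= q], the next one
    satisfies [q^2 - p^2 >= 8/9 q^2 >= 3 q], so both bounds persist. *)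
Lemma magnitude_step r :
  4 <= magnitude r /\ 3 * magnitude r <= magnitude r.+1.
Proof.
elim: r => [|r [c4 c3]]; first by rewrite magnitude1 /magnitude /=; split; lra.
by rewrite magnitudeSS; split; nra.
Qed.

Lemma magnitude_ge r : r%:R <= magnitude r.
Proof.
elim: r => [|r IHr]; first by rewrite /magnitude /=.
by have [c4 c3] := magnitude_step r; rewrite -natr1; lra.
Qed.

Definition trajectory (alpha : R) (r : nat) : 'cV[R]_2 :=
  - (magnitude r / alpha) *: disagreement.

Lemma W_trajectory alpha r : averaging *m trajectory alpha r = 0.
Proof. by rewrite -scalemxAr W_disagreement scaler0. Qed.

Lemma trajectory_GT alpha : 0 < alpha ->
  GT_iteration cubic averaging alpha (trajectory alpha 0) (trajectory alpha).
Proof.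
move=> alpha_gt0; have alpha_neq0 : alpha != 0 by rewrite gt_eqF.
split=> // [|[//|r] _].
  rewrite W_trajectory grad_disagreement sub0r scalerA -scaleNr.
  by rewrite /trajectory magnitude1; congr (_ *: _); field.
rewrite /= -mulmxA !W_trajectory mulmx0 scaler0 subr0 sub0r.
rewrite !grad_disagreement !scalerA -scaleNr -scalerDl.
by rewrite /trajectory magnitudeSS; congr (_ *: _); field.
Qed.

Lemma trajectory_diverges alpha : 0 < alpha ->
  diverges_to_infinity (trajectory alpha).
Proof.
move=> alpha_gt0; apply/cvgryPge => A.
near=> r.
have le_c : magnitude r / alpha <= enorm (trajectory alpha r).
  have c_ge0 : 0 <= magnitude r / alpha.
    by rewrite divr_ge0 ?ltW //; have [] := magnitude_step r; lra.
  rewrite /enorm -[leLHS](ger0_norm c_ge0) -sqrtr_sqr ler_wsqrtr //.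
  rewrite big_ord_recl !mxE mulr1 sqrrN lerDl.
  by apply: sumr_ge0 => i _; exact: sqr_ge0.
apply: le_trans le_c; rewrite ler_pdivlMr //.
apply: le_trans (magnitude_ge r).
near: r; exact: nbhs_infty_ger.
Unshelve. all: by end_near.
Qed.

End Counterexample.

Theorem claim2 (R : realType) :
  exists (N : nat) (e : rel 'I_N) (f : 'I_N -> R -> R),
    (0 < N)%N /\
    connected_graph e /\
    (forall i : 'I_N, C1 (f i)) /\
    GLC f /\
    exists W : 'M[R]_N,
      mixing_matrix e W /\
      forall alpha : R, 0 < alpha ->
        exists (x0 : 'cV[R]_N) (x : nat -> 'cV[R]_N),
          GT_iteration f W alpha x0 x /\ diverges_to_infinity x.
Proof.
exists 2, complete_rel, (@cubic R); split=> //.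
split; first exact: complete_connected.
split; first exact: cubic_C1.
split; first exact: cubic_GLC.
exists (averaging R); split; first exact: averaging_mixing.
move=> alpha alpha_gt0; exists (trajectory R alpha 0), (trajectory R alpha).
by split; [exact: trajectory_GT | exact: trajectory_diverges].
Qed.
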